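(* Let $(\mathcal X,\mathsf d_{\mathcal X})$ be a geodesic metric space with cone $(\mathcal C,\mathsf d_{\mathcal C})$. Let $x_0,x_1\in\mathcal X$ with $0<\mathsf d_{\mathcal X}(x_0,x_1)<\pi$, let $r_0,r_1>0$, put $z_0=[x_0,r_0]$, $z_1=[x_1,r_1]$, and let $\boldsymbol z_{01}\in\mathrm{Geod}(z_0,z_1)$, written as $\boldsymbol z_{01}(t)=[\overline{\boldsymbol x}_{01}(t),\boldsymbol r_{01}(t)]$. Then $$t\mapsto \boldsymbol x_{01}(t)=\overline{\boldsymbol x}_{01}(\beta_{01}(t))\quad\text{with}\quad \beta_{01}(t)=\frac{r_0\sin\big(t\,\mathsf d_{\mathcal X}(x_0,x_1)\big)}{r_1\sin\big((1-t)\mathsf d_{\mathcal X}(x_0,x_1)\big)+r_0\sin\big(t\,\mathsf d_{\mathcal X}(x_0,x_1)\big)}$$ is an element of $\mathrm{Geod}(x_0,x_1)$. Furthermore, for $t\in[0,1]$, $$\boldsymbol r_{01}(\beta_{01}(t))=\frac{r_0r_1\sin(\mathsf d_{\mathcal X}(x_0,x_1))}{r_1\sin\big((1-t)\mathsf d_{\mathcal X}(x_0,x_1)\big)+r_0\sin\big(t\,\mathsf d_{\mathcal X}(x_0,x_1)\big)}.$$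
   Context: The cone $\mathcal C$ over $(\mathcal X,\mathsf d_{\mathcal X})$ is the quotient of $\mathcal X\times[0,\infty)$ obtained by identifying all points of $\mathcal X\times\{0\}$ with one point $\boldsymbol 0$ (the apex); the class of $(x,r)$ is written $[x,r]$, and $\mathsf d_{\mathcal C}^2([x_0,r_0],[x_1,r_1])=r_0^2+r_1^2-2r_0r_1\cos(\min\{\pi,\mathsf d_{\mathcal X}(x_0,x_1)\})$. A metric space is geodesic if any two points are joined by a continuous curve whose length equals their distance. For points $y_0,y_1$ of a metric space $(Y,\mathsf d)$, $\mathrm{Geod}(y_0,y_1)$ is the set of constant-speed geodesics $\boldsymbol y:[0,1]\to Y$ joining them, i.e. $\boldsymbol y(0)=y_0$, $\boldsymbol y(1)=y_1$, $\mathsf d(\boldsymbol y(s),\boldsymbol y(t))=|t-s|\,\mathsf d(y_0,y_1)$. *)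

(* Defs.v *)
From HB Require Import structures.
From mathcomp Require Import all_boot all_order all_algebra.
From mathcomp Require Import generic_quotient.
From mathcomp Require Import all_classical all_reals all_analysis.
From mathcomp Require Import ring lra.
Import Order.TTheory GRing.Theory Num.Theory.
Import numFieldNormedType.Exports.

Set Implicit Arguments.
Unset Strict Implicit.
Unset Printing Implicit Defensive.

Local Open Scope classical_set_scope.
Local Open Scope ring_scope.
Local Open Scope quotient_scope.

Section Geodesics.
Context {R : realType} {Y : metricType R}.

(* The analogues of [variation] and [total_variation] of realfun.v for curves
   in a metric space. *)
Definition polygonal_length (a b : R) (y : R -> Y) (s : seq R) : R :=
  let F := y \o nth b (a :: s) in
  \sum_(0 <= n < size s) mdist (F n) (F n.+1).

Definition curve_length (a b : R) (y : R -> Y) : \bar R :=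
  ereal_sup [set (polygonal_length a b y s)%:E | s in itv_partition a b].

(* Curves on [0, 1] are functions on R of which only the restriction to [0, 1]
   is constrained. *)
Definition Geod (y0 y1 : Y) : set (R -> Y) :=
  [set y | [/\ y 0 = y0, y 1 = y1 &
    forall s t, 0 <= s <= 1 -> 0 <= t <= 1 ->
      mdist (y s) (y t) = `|t - s| * mdist y0 y1]].

End Geodesics.

Definition geodesic_space {R : realType} (Y : metricType R) : Prop :=
  forall y0 y1 : Y, exists y : R -> Y,
    [/\ {within `[0, 1], continuous y}, y 0 = y0, y 1 = y1 &
        curve_length 0 1 y = (mdist y0 y1)%:E].

Section Cone.
Context {R : realType} (X : metricType R).

Definition cone_eq (p q : X * {nonneg R}) : bool :=
  (p == q) || ((p.2%:num == 0) && (q.2%:num == 0)).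

Lemma cone_eq_refl : reflexive cone_eq.
Proof. by move=> p; rewrite /cone_eq eqxx. Qed.

Lemma cone_eq_sym : symmetric cone_eq.
Proof. by move=> p q; rewrite /cone_eq eq_sym andbC. Qed.

Lemma cone_eq_trans : transitive cone_eq.
Proof.
move=> q p s /orP[/eqP->//|/andP[p0 q0]] /orP[/eqP<-|/andP[_ s0]].
  by rewrite /cone_eq p0 q0 orbT.
by rewrite /cone_eq p0 s0 orbT.
Qed.

Canonical cone_equiv := EquivRel cone_eq cone_eq_refl cone_eq_sym cone_eq_trans.

Definition cone : Type := {eq_quot cone_equiv}.

HB.instance Definition _ := Choice.on cone.
HB.instance Definition _ := Quotient.on cone.

(* The class [x, r]. *)
Definition cone_pt (x : X) (r : {nonneg R}) : cone := \pi_cone (x, r).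

Definition cone_angle (x y : X) : R := Num.min pi (mdist x y).

Definition cone_sqdist (p q : X * {nonneg R}) : R :=
  p.2%:num ^+ 2 + q.2%:num ^+ 2
  - 2 * p.2%:num * q.2%:num * cos (cone_angle p.1 q.1).

Definition cone_dist (z w : cone) : R := Num.sqrt (cone_sqdist (repr z) (repr w)).

Lemma cone_angle_bounds x y : 0 <= cone_angle x y <= pi.
Proof. by rewrite le_min pi_ge0 mdist_ge0/= ge_min lexx. Qed.

Lemma cone_angle_sym x y : cone_angle x y = cone_angle y x.
Proof. by rewrite /cone_angle metric_sym. Qed.

Lemma cone_anglexx x : cone_angle x x = 0.
Proof. by rewrite /cone_angle mdistxx min_r ?pi_ge0. Qed.

Lemma cone_angle_eq0 x y : cone_angle x y = 0 -> x = y.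
Proof.
rewrite /cone_angle minEle; case: ifP => _ h; last exact: mdist_positivity.
by have := pi_gt0 R; rewrite h ltxx.
Qed.

Lemma cone_angle_triangle y x z :
  cone_angle x z <= cone_angle x y + cone_angle y z.
Proof.
rewrite /cone_angle; have t := metric_triangle x y z.
have := mdist_ge0 x y; have := mdist_ge0 y z; have := @pi_ge0 R.
by rewrite !minEle; do 3 case: ifPn; rewrite -?ltNge; lra.
Qed.

Lemma cone_sqdist_ge0 p q : 0 <= cone_sqdist p q.
Proof.
have -> : cone_sqdist p q = (p.2%:num - q.2%:num) ^+ 2
    + 2 * (p.2%:num * q.2%:num * (1 - cos (cone_angle p.1 q.1))).
  by rewrite /cone_sqdist; ring.
by rewrite addr_ge0 ?sqr_ge0// !mulr_ge0// subr_ge0 cos_le1.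
Qed.

Lemma cone_sqdist_eq0 p q : cone_sqdist p q = 0 -> cone_eq p q.
Proof.
have -> : cone_sqdist p q = (p.2%:num - q.2%:num) ^+ 2
    + 2 * (p.2%:num * q.2%:num * (1 - cos (cone_angle p.1 q.1))).
  by rewrite /cone_sqdist; ring.
move/eqP; rewrite paddr_eq0 ?sqr_ge0//.
rewrite sqrf_eq0 subr_eq0 => /andP[/eqP pq].
rewrite /cone_eq pq andbb mulf_eq0 pnatr_eq0/= mulf_eq0 mulf_eq0 orbb.
case/orP => [->|]; first by rewrite orbT.
rewrite subr_eq0 eq_sym -(@cos0 R) => /eqP /cos_inj c0.
suff -> : p = q by rewrite eqxx.
case: p q pq c0 => [x r] [y s] /= rs c0; congr pair; last exact: val_inj.
by apply/cone_angle_eq0/c0; rewrite in_itv/= ?cone_angle_bounds// lexx pi_ge0.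
Qed.

Lemma cone_sqdist_sym p q : cone_sqdist p q = cone_sqdist q p.
Proof. by rewrite /cone_sqdist cone_angle_sym; ring. Qed.

Lemma cone_sqdist_apex p p' q : p.2%:num = 0 -> p'.2%:num = 0 ->
  cone_sqdist p q = cone_sqdist p' q.
Proof. by rewrite /cone_sqdist => -> ->; ring. Qed.

Lemma cone_sqdist_eql p p' q : cone_eq p p' ->
  cone_sqdist p q = cone_sqdist p' q.
Proof.
by case/orP => [/eqP->//|/andP[/eqP p0 /eqP p'0]]; exact: cone_sqdist_apex.
Qed.

Lemma cone_eq_repr (p : X * {nonneg R}) : cone_eq (repr (\pi_cone p)) p.
Proof. by apply/(@eqmodP _ cone_equiv); rewrite reprK. Qed.

Lemma cone_distE x y r s : cone_dist (cone_pt x r) (cone_pt y s) ^+ 2 =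
  r%:num ^+ 2 + s%:num ^+ 2
  - 2 * r%:num * s%:num * cos (Num.min pi (mdist x y)).
Proof.
rewrite /cone_dist sqr_sqrtr ?cone_sqdist_ge0//.
rewrite (cone_sqdist_eql _ (cone_eq_repr _)) cone_sqdist_sym.
by rewrite (cone_sqdist_eql _ (cone_eq_repr _)) cone_sqdist_sym.
Qed.

Lemma cone_distxx z : cone_dist z z = 0.
Proof.
by rewrite /cone_dist /cone_sqdist cone_anglexx cos0 -[RHS]sqrtr0; congr Num.sqrt; ring.
Qed.

Lemma cone_dist_positivity z w : cone_dist z w = 0 -> z = w.
Proof.
move/eqP; rewrite sqrtr_eq0 => zw; rewrite -[z]reprK -[w]reprK.
apply/(@eqmodP _ cone_equiv)/cone_sqdist_eq0/eqP.
by rewrite eq_le zw cone_sqdist_ge0.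
Qed.

Lemma cone_dist_sym z w : cone_dist z w = cone_dist w z.
Proof. by rewrite /cone_dist cone_sqdist_sym. Qed.

Let norm2_triangle (x1 x2 y1 y2 : R) :
  Num.sqrt ((x1 + y1) ^+ 2 + (x2 + y2) ^+ 2) <=
  Num.sqrt (x1 ^+ 2 + x2 ^+ 2) + Num.sqrt (y1 ^+ 2 + y2 ^+ 2).
Proof.
set A := x1 ^+ 2 + x2 ^+ 2; set B := y1 ^+ 2 + y2 ^+ 2.
have A0 : 0 <= A by rewrite addr_ge0 ?sqr_ge0.
have B0 : 0 <= B by rewrite addr_ge0 ?sqr_ge0.
rewrite -(@ler_pXn2r _ 2)// ?nnegrE ?addr_ge0 ?sqrtr_ge0//.
rewrite sqr_sqrtr ?addr_ge0 ?sqr_ge0// [leRHS]sqrrD !sqr_sqrtr//.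
have h : x1 * y1 + x2 * y2 <= Num.sqrt A * Num.sqrt B.
  rewrite -sqrtrM//; apply: (le_trans (ler_norm _)).
  rewrite -sqrtr_sqr ler_wsqrtr// -subr_ge0.
  by have := sqr_ge0 (x1 * y2 - x2 * y1); congr (_ <= _); rewrite /A /B; ring.
by move: h; rewrite mulr2n /A /B; nra.
Qed.

Lemma cone_dist_triangle w z v : cone_dist z v <= cone_dist z w + cone_dist w v.
Proof.
rewrite /cone_dist /cone_sqdist.
case: (repr z) (repr w) (repr v) => [x r] [y s] [u t] /=.
have /andP[a0 api] := cone_angle_bounds x y.
have /andP[b0 bpi] := cone_angle_bounds y u.
have /andP[c0 cpi] := cone_angle_bounds x u.
have cab := cone_angle_triangle y x u.
set a := cone_angle x y in a0 api cab *; set b := cone_angle y u in b0 bpi cab *.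
set c := cone_angle x u in c0 cpi cab *.
have r0 : 0 <= r%:num by []. have s0 : 0 <= s%:num by [].
have t0 : 0 <= t%:num by [].
move: r%:num s%:num t%:num r0 s0 t0 => {}r {}s {}t r0 s0 t0.
have cos_anti (e f : R) : 0 <= e -> e <= f -> f <= pi -> cos f <= cos e.
  move=> e0 ef fpi; rewrite leNgt ltr_cos -?leNgt ?in_itv/= ?e0 ?fpi ?(le_trans e0)//.
  by rewrite (le_trans ef).
have Ea : r ^+ 2 + s ^+ 2 - 2 * r * s * cos a
    = (r * cos a - s) ^+ 2 + (r * sin a) ^+ 2.
  by have := sin2cos2 a => e; ring: e.
have Eb : s ^+ 2 + t ^+ 2 - 2 * s * t * cos b
    = (s - t * cos b) ^+ 2 + (t * sin b) ^+ 2.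
  by have := sin2cos2 b => e; ring: e.
have [abpi|piab] := leP (a + b) pi.
  rewrite Ea Eb; apply: le_trans (norm2_triangle _ _ _ _).
  apply: ler_wsqrtr.
  have -> : (r * cos a - s + (s - t * cos b)) ^+ 2
      + (r * sin a + t * sin b) ^+ 2
      = r ^+ 2 + t ^+ 2 - 2 * r * t * cos (a + b).
    have ea := sin2cos2 a; have eb := sin2cos2 b.
    by rewrite cosD; ring: ea eb.
  by rewrite lerD2l lerN2 ler_wpM2l ?mulr_ge0//; exact: cos_anti.
have cosab : cos a + cos b <= 0.
  have : cos b <= cos (pi - a) by apply: cos_anti => //; lra.
  by rewrite cosB cospi sinpi; lra.
have sqrt_ge (p q : R) : p <= Num.sqrt (p ^+ 2 + q ^+ 2).
  apply: (le_trans (ler_norm _)); rewrite -sqrtr_sqr ler_wsqrtr//.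
  by rewrite lerDl sqr_ge0.
have ha : r - s * cos a <= Num.sqrt (r ^+ 2 + s ^+ 2 - 2 * r * s * cos a).
  have -> : r ^+ 2 + s ^+ 2 - 2 * r * s * cos a
    = (r - s * cos a) ^+ 2 + (s * sin a) ^+ 2.
    by have := sin2cos2 a => e; ring: e.
  exact: sqrt_ge.
have hb : t - s * cos b <= Num.sqrt (s ^+ 2 + t ^+ 2 - 2 * s * t * cos b).
  have -> : s ^+ 2 + t ^+ 2 - 2 * s * t * cos b
    = (t - s * cos b) ^+ 2 + (s * sin b) ^+ 2.
    by have := sin2cos2 b => e; ring: e.
  exact: sqrt_ge.
apply: (@le_trans _ _ (r + t)); last first.
  by apply: le_trans (lerD ha hb); nra.
rewrite -[leRHS]ger0_norm ?addr_ge0// -sqrtr_sqr ler_wsqrtr//.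
have := cos_geN1 c; have := mulr_ge0 r0 t0; nra.
Qed.

HB.instance Definition _ := isMetric.Build R cone
  cone_distxx cone_dist_positivity cone_dist_sym cone_dist_triangle.

Lemma mdist_coneE x y r s : mdist (cone_pt x r) (cone_pt y s) ^+ 2 =
  r%:num ^+ 2 + s%:num ^+ 2
  - 2 * r%:num * s%:num * cos (Num.min pi (mdist x y)).
Proof. exact: cone_distE. Qed.

Lemma cone_pt_apex x y : cone_pt x 0%:nng = cone_pt y 0%:nng.
Proof. by apply/(@eqmodP _ cone_equiv); rewrite /= /cone_eq /= eqxx orbT. Qed.

End Cone.

(* Main.v *)
Require Import Defs.
From HB Require Import structures.
From mathcomp Require Import all_boot all_order all_algebra.
From mathcomp Require Import generic_quotient.
From mathcomp Require Import all_classical all_reals all_analysis.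
From mathcomp Require Import ring lra.
Import Order.TTheory GRing.Theory Num.Theory.
Import numFieldNormedType.Exports.

Local Open Scope classical_set_scope.
Local Open Scope ring_scope.

(** Put [x0], [x1] in polar form in the Euclidean plane at angle [d]. Comparing
    with the triangle inequality for the angles [(x0, x)] and [(x, x1)] forces a
    point [[x, r]] on a cone geodesic at parameter [s] to have the radius [r] of
    the corresponding point of the Euclidean segment. The segment, seen from the
    origin at angle [t * d], has parameter [beta01 t]; the law of cosines between
    two intermediate points then gives back their angle, which is smaller than
    [pi] and hence is their distance in the base. *)

Lemma cone_pt_inj {R : realType} {X : metricType R} {x y : X} {r s : {nonneg R}} :
  0 < s%:num -> cone_pt x r = cone_pt y s -> x = y /\ r = s.
Proof.
move=> s0 /(@eqmodP _ (cone_equiv X)) /= /orP[/eqP[-> ->]//|/andP[_ /eqP /= h]].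
by move: s0; rewrite h ltxx.
Qed.

Lemma ler_cos {R : realType} (e f : R) :
  0 <= e -> e <= f -> f <= pi -> cos f <= cos e.
Proof.
move=> e0 ef fpi; rewrite leNgt ltr_cos -?leNgt ?in_itv/= ?e0 ?fpi ?(le_trans e0)//.
by rewrite (le_trans ef).
Qed.

Lemma le_of_sqrD {R : realDomainType} {u v N : R} :
  0 <= N -> u ^+ 2 + v ^+ 2 = N ^+ 2 -> u <= N.
Proof. by move=> N0 e; have := sqr_ge0 v; nra. Qed.

(** In the plane, [N] is the length of the sum of two vectors of lengths [P] and [Q] at angle [d].
    The left side is at most a projection of this sum: onto the direction at angle [a] from the
    first vector if [a <= d], onto the second vector otherwise. *)
Lemma le_cos_comb {R : realType} {P Q N a b d : R} :
  0 <= P -> 0 <= Q -> 0 <= N -> 0 <= a <= pi -> 0 <= b <= pi -> 0 <= d ->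
  d <= a + b -> N ^+ 2 = P ^+ 2 + Q ^+ 2 + 2 * P * Q * cos d ->
  P * cos a + Q * cos b <= N.
Proof.
move=> P0 Q0 N0 /andP[a0 api] /andP[b0 bpi] d0 dab NE.
have ed := sin2cos2 d.
have [ad|/ltW da] := leP a d.
  have cb : cos b <= cos (d - a) by apply: ler_cos; lra.
  apply: (@le_trans _ _ (P * cos a + Q * cos (d - a))).
    by rewrite lerD2l ler_wpM2l.
  apply: (@le_of_sqrD _ _ (P * sin a - Q * sin (d - a))) => //.
  have ea := sin2cos2 a.
  by rewrite NE cosB sinB; ring: ed ea.
apply: (@le_trans _ _ (P * cos d + Q)).
  apply: lerD; first by rewrite ler_wpM2l// ler_cos.
  by rewrite ler_piMr// cos_le1.
apply: (@le_of_sqrD _ _ (P * sin d)) => //.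
by rewrite NE; ring: ed.
Qed.

Lemma cone_geod_radius {R : realType} (X : metricType R) (x0 x x1 : X)
    (r0 r r1 : {nonneg R}) (s : R) : 0 <= s <= 1 ->
  let D := mdist (cone_pt x0 r0) (cone_pt x1 r1) in
  mdist (cone_pt x0 r0) (cone_pt x r) = s * D ->
  mdist (cone_pt x r) (cone_pt x1 r1) = (1 - s) * D ->
  r%:num ^+ 2 = ((1 - s) * r0%:num) ^+ 2 + (s * r1%:num) ^+ 2
    + 2 * ((1 - s) * r0%:num) * (s * r1%:num) * cos (cone_angle x0 x1).
Proof.
move=> /andP[s0 s1] D /(congr1 (fun y => y ^+ 2)) e0 /(congr1 (fun y => y ^+ 2)) e1.
move: e0 e1; rewrite [(s * D) ^+ 2]exprMn [((1 - s) * D) ^+ 2]exprMn.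
rewrite {}/D !mdist_coneE -!/(cone_angle _ _).
have abd := cone_angle_triangle x x0 x1.
have a_bd := cone_angle_bounds x0 x; have b_bd := cone_angle_bounds x x1.
have /andP[d0 _] := cone_angle_bounds x0 x1.
move: (cone_angle x0 x) (cone_angle x x1) (cone_angle x0 x1) a_bd b_bd d0 abd.
move=> a b d a_bd b_bd d0 abd.
have r_ge0 : 0 <= r%:num by [].
have P0 : 0 <= (1 - s) * r0%:num by rewrite mulr_ge0// subr_ge0.
have Q0 : 0 <= s * r1%:num by rewrite mulr_ge0.
move: r%:num r0%:num r1%:num r_ge0 P0 Q0 => {}r {}r0 {}r1 r_ge0 P0 Q0 e0 e1.
set P := (1 - s) * r0; set Q := s * r1.
have NN : P ^+ 2 + Q ^+ 2 + 2 * P * Q * cos d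
    = (P + Q * cos d) ^+ 2 + (Q * sin d) ^+ 2.
  by have ed := sin2cos2 d; ring: ed.
have NN0 : 0 <= P ^+ 2 + Q ^+ 2 + 2 * P * Q * cos d.
  by rewrite NN addr_ge0// sqr_ge0.
set N := Num.sqrt (P ^+ 2 + Q ^+ 2 + 2 * P * Q * cos d).
have NE : N ^+ 2 = P ^+ 2 + Q ^+ 2 + 2 * P * Q * cos d by rewrite sqr_sqrtr.
have N0 : 0 <= N by exact: sqrtr_ge0.
have le_N := le_cos_comb P0 Q0 N0 a_bd b_bd d0 abd NE.
rewrite -NE; congr (_ ^+ 2); apply/eqP; rewrite -subr_eq0 -sqrf_eq0 eq_le sqr_ge0.
rewrite andbT.
(* As in Stewart's theorem, [1 - s] times [e0] plus [s] times [e1] has right side [s * (1 - s)]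
   times the squared distance of the endpoints. With [le_N], this bounds the square of [r - N] by
   [0]. *)
have e : r ^+ 2 + N ^+ 2 = 2 * r * (P * cos a + Q * cos b).
  rewrite NE /P /Q.
  have := congr1 (fun y => (1 - s) * y) e0.
  have := congr1 (fun y => s * y) e1.
  lra.
have : r * (P * cos a + Q * cos b) <= r * N by rewrite ler_wpM2l.
by rewrite sqrrB; lra.
Qed.

Theorem theorem2p7 (R : realType) (X : metricType R) (hX : geodesic_space X)
    (x0 x1 : X) (hx : 0 < mdist x0 x1 < pi)
    (r0 r1 : {nonneg R}) (hr0 : 0 < r0%:num) (hr1 : 0 < r1%:num)
    (z01 : R -> cone X) (hz : Geod (cone_pt x0 r0) (cone_pt x1 r1) z01)
    (xbar01 : R -> X) (r01 : R -> {nonneg R})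
    (hrep : forall t : R, 0 <= t <= 1 -> z01 t = cone_pt (xbar01 t) (r01 t)) :
  let d : R := mdist x0 x1 in
  let den (t : R) : R :=
    r1%:num * sin ((1 - t) * d) + r0%:num * sin (t * d) in
  let beta01 (t : R) : R := r0%:num * sin (t * d) / den t in
  Geod x0 x1 (fun t : R => xbar01 (beta01 t)) /\
  (forall t : R, 0 <= t <= 1 ->
    (r01 (beta01 t))%:num = r0%:num * r1%:num * sin d / den t).
Proof.
move=> d den beta.
have /andP[d0 dpi] := hx; rewrite -/d in d0 dpi.
have ang01 : cone_angle x0 x1 = d by rewrite /cone_angle min_r// ltW.
have [z0 z1 zst] := hz.
have sin_pos t : 0 < t <= 1 -> 0 < sin (t * d).
  by move=> /andP[t0 t1]; apply: sin_gt0_pi; rewrite ?in_itv /=; nra.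
have sin_nneg t : 0 <= t <= 1 -> 0 <= sin (t * d).
  rewrite le_eqVlt => /andP[/orP[/eqP<- _|t0 t1]]; first by rewrite mul0r sin0.
  by rewrite ltW// sin_pos// t0.
have den_pos t : 0 <= t <= 1 -> 0 < den t.
  move=> t01; have /andP[t0 t1] := t01.
  have A := sin_nneg t t01.
  have B : 0 <= sin ((1 - t) * d) by apply: sin_nneg; lra.
  (* The two sines never vanish together: the first is positive for [t < 1], the second at
     [t = 1]. *)
  rewrite /den; have [t_lt|t_ge] := ltP t 1.
    apply: ltr_wpDr; first by rewrite mulr_ge0.
    by rewrite mulr_gt0// sin_pos//; lra.
  apply: ltr_wpDl; first by rewrite mulr_ge0.
  by rewrite mulr_gt0// sin_pos//; lra.
have beta01 t : 0 <= t <= 1 -> 0 <= beta t <= 1.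
  move=> t01; rewrite /beta ler_pdivlMr ?ler_pdivrMr ?den_pos// mul0r mul1r.
  rewrite mulr_ge0 ?sin_nneg//= /den lerDr mulr_ge0// sin_nneg//.
  by move: t01 => /andP[? ?]; lra.
have sinE t : sin ((1 - t) * d) = sin d * cos (t * d) - cos d * sin (t * d).
  by rewrite mulrBl mul1r sinB.
have sd_pos : 0 < sin d by have := sin_pos 1; rewrite mul1r; apply; lra.
pose rho t := r0%:num * r1%:num * sin d / den t.
have rho_gt0 t : 0 <= t <= 1 -> 0 < rho t.
  by move=> t01; rewrite /rho divr_gt0 ?den_pos// !mulr_gt0.
(* [(rho t, t * d)] are polar coordinates of a point of the segment *)
have rho_cos t : 0 <= t <= 1 -> rho t * cos (t * d)
    = (1 - beta t) * r0%:num + beta t * r1%:num * cos d.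
  move=> /den_pos; rewrite /rho /beta /den sinE => den0.
  by field; rewrite gt_eqF.
have rho_sin t : 0 <= t <= 1 -> rho t * sin (t * d)
    = beta t * r1%:num * sin d.
  move=> /den_pos den0; rewrite /rho /beta.
  by field; rewrite gt_eqF.
have in0 : 0 <= (0 : R) <= 1 by lra.
have in1 : 0 <= (1 : R) <= 1 by lra.
have radius t : 0 <= t <= 1 -> (r01 (beta t))%:num = rho t.
  move=> t01; have b01 := beta01 t t01; have /andP[b0 b1] := b01.
  (* The two distance hypotheses are the constant-speed equations of [z01] between [beta t] and the
     endpoints [0] and [1]. *)
  have := cone_geod_radius X x0 (xbar01 (beta t)) x1 r0 (r01 (beta t)) r1 _ b01.
  rewrite /= -hrep// -{1}z0 -{2}z1 !zst// subr0 ger0_norm// ger0_norm ?subr_ge0//.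
  move=> /(_ erefl erefl); rewrite ang01 => e.
  apply/eqP; rewrite -(@eqrXn2 _ 2)//; last by rewrite ltW// rho_gt0.
  apply/eqP; rewrite e.
  have ec := rho_cos t t01; have es := rho_sin t t01.
  (* Both sides are the squared norm of the same point of the segment, here passed to Cartesian
     coordinates. *)
  have -> : rho t ^+ 2 = (rho t * cos (t * d)) ^+ 2 + (rho t * sin (t * d)) ^+ 2.
    by have e2 := sin2cos2 (t * d); ring: e2.
  by rewrite ec es; have e2 := sin2cos2 d; ring: e2.
split=> [|t t01]; last exact: radius.
have beta0 : beta 0 = 0 by rewrite /beta mul0r sin0 mulr0 mul0r.
have beta1 : beta 1 = 1.
  rewrite /beta /den subrr mul0r sin0 mulr0 add0r divff// mulf_neq0 ?gt_eqF//.
  by rewrite mul1r.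
split.
(* The endpoints have positive radius, so their classes determine the base points. *)
- by rewrite beta0; move: z0; rewrite hrep// => /cone_pt_inj [].
- by rewrite beta1; move: z1; rewrite hrep// => /cone_pt_inj [].
move=> s t s01 t01; rewrite -/d.
have := zst _ _ (beta01 s s01) (beta01 t t01).
rewrite !hrep ?beta01// => /(congr1 (fun y => y ^+ 2)).
rewrite exprMn !mdist_coneE -!/(cone_angle _ _) ang01 !radius//.
rewrite real_normK ?num_real//.
set th := cone_angle _ _ => e.
have td : 0 <= `|t - s| * d <= pi.
  have /andP[s0 s1] := s01; have /andP[t0 t1] := t01.
  have : `|t - s| <= 1 by rewrite ler_norml; lra.
  by have := normr_ge0 (t - s); nra.
have cosE : cos th = cos (`|t - s| * d).
  have -> : cos (`|t - s| * d) = cos ((t - s) * d).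
    by rewrite -{1}(gtr0_norm d0) -normrM cos_norm.
  have rr : 2 * rho s * rho t != 0.
    have rs := rho_gt0 s s01; have rt := rho_gt0 t t01.
    by rewrite mulf_neq0 ?(gt_eqF rt)// mulf_neq0 ?(gt_eqF rs).
  (* Scaled by [2 * rho s * rho t], the right side is twice the inner product of two points of the
     segment. By [e], the left side is the sum of their squared norms minus their squared distance,
     so polarization gives equality. *)
  apply: (mulfI rr); rewrite mulrBl cosB.
  have cs := rho_cos s s01; have ss := rho_sin s s01.
  have ct := rho_cos t t01; have st := rho_sin t t01.
  have e2 := sin2cos2 d; have es := sin2cos2 (s * d); have et := sin2cos2 (t * d).
  have rs : rho s ^+ 2 = (rho s * cos (s * d)) ^+ 2 + (rho s * sin (s * d)) ^+ 2.
    by ring: es.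
  have rt : rho t ^+ 2 = (rho t * cos (t * d)) ^+ 2 + (rho t * sin (t * d)) ^+ 2.
    by ring: et.
  have -> : 2 * rho s * rho t
      * (cos (t * d) * cos (s * d) + sin (t * d) * sin (s * d))
    = 2 * ((rho t * cos (t * d)) * (rho s * cos (s * d))
         + (rho t * sin (t * d)) * (rho s * sin (s * d))) by ring.
  have -> : 2 * rho s * rho t * cos th
    = rho s ^+ 2 + rho t ^+ 2
      - (rho s ^+ 2 + rho t ^+ 2 - 2 * rho s * rho t * cos th).
    by ring.
  by rewrite e rs rt cs ss ct st; ring: e2.
have thE : th = `|t - s| * d.
  by apply: cos_inj => //; rewrite in_itv/= ?cone_angle_bounds.
(* Strictness excludes the case where the minimum in [cone_angle] is [pi]. *)
have td_lt : `|t - s| * d < pi.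
  have /andP[s0 s1] := s01; have /andP[t0 t1] := t01.
  have : `|t - s| <= 1 by rewrite ler_norml; lra.
  by have := normr_ge0 (t - s); nra.
move: thE td_lt; rewrite /th /cone_angle minEle; case: ifP => [_ <-|//].
by rewrite ltxx.
Qed.
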